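(* Let $P$ be a poset on $[n]$ of width two, written as $P=P_1\cup P_2$ with $P_1,P_2$ chains (totally ordered subsets) of $P$. Then \[ {\sf Poin}(P,t)=\sum_{\sigma\in\mathcal{L}(P)}t^{\operatorname{des}_{P_1,P_2}(\sigma)}, \] where $\operatorname{des}_{P_1,P_2}(\sigma)=\#\{i\in[n-1]:\sigma_i\in P_2,\ \sigma_{i+1}\in P_1,\ \sigma_i,\sigma_{i+1}\text{ incomparable in }P\}$.
   Context: Width of $P$ is the maximum size of an antichain. $\mathcal{L}(P)$ is the set of linear extensions: permutations $\sigma=[\sigma_1,\dots,\sigma_n]$ of $[n]$ such that $i<_Pj$ implies $i$ precedes $j$. $H_{ij}=\{x\in\mathbb{R}^n:x_i=x_j\}$; $\mathcal{L}$ is the set of intersections of subsets of these hyperplanes (including $V=\mathbb{R}^n$), ordered by reverse inclusion, with Möbius function $\mu$; $\mathcal{K}_P=\{x:x_i<x_j\text{ whenever }i<_Pj\}$; $\mathcal{L}^{int}(\mathcal{K}_P)=\{X\in\mathcal{L}:X\cap\mathcal{K}_P\ne\emptyset\}$; ${\sf Poin}(P,t)=\sum_kc_k(P)t^k$ with $c_k(P)=\sum_{X\in\mathcal{L}^{int}(\mathcal{K}_P),\operatorname{codim}X=k}|\mu(V,X)|$. *)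

(* Defs.v *)
From HB Require Import structures.
From mathcomp Require Import all_boot all_order all_fingroup all_algebra.
From mathcomp Require Import boolp reals.

Set Implicit Arguments.
Unset Strict Implicit.
Unset Printing Implicit Defensive.

Import Order.TTheory GRing.Theory Num.Theory.
Local Open Scope ring_scope.

Section Moebius.
Context {d : Order.disp_t} {T : finPOrderType d}.
Implicit Types x y z : T.

(* The recursion on [k] only bounds the depth: [moebius_id] and [moebius_lt]
   show that the fuel [#|T|] is always sufficient. *)
Fixpoint moebius_rec (k : nat) x y : int :=
  if x == y then 1 else
  if k is k'.+1 then - \sum_(z : T | (x <= z < y)%O) moebius_rec k' x z else 0.

Definition moebius x y : int := moebius_rec #|T| x y.

Lemma moebius_id x : moebius x x = 1.
Proof. by rewrite /moebius; case: #|T| => [|k] /=; rewrite eqxx. Qed.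

Lemma moebius_recE k x y : (#|[pred z : T | (x <= z < y)%O]| <= k)%N ->
  moebius_rec k x y = moebius x y.
Proof.
suff fuel m : forall l w, (#|[pred z : T | (x <= z < w)%O]| <= m)%N ->
    (#|[pred z : T | (x <= z < w)%O]| <= l)%N ->
    moebius_rec m x w = moebius_rec l x w.
  by move=> lek; apply: fuel => //; apply: max_card.
elim: m => [|m IH] [|l] w //=; case: eqP => // _ lem lel.
- rewrite big_pred0 ?oppr0 // => z; apply/negbTE/negP => xzw.
  by move: lem; rewrite leqn0 => /eqP/card0_eq/(_ z); rewrite inE xzw.
- rewrite big_pred0 ?oppr0 // => z; apply/negbTE/negP => xzw.
  by move: lel; rewrite leqn0 => /eqP/card0_eq/(_ z); rewrite inE xzw.
- congr (- _); apply: eq_bigr => z /andP[xz zw].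
  have lt_card : (#|[pred u : T | (x <= u < z)%O]| <
                  #|[pred u : T | (x <= u < w)%O]|)%N.
    apply/proper_card/properP; split.
      apply/subsetP => u; rewrite !inE => /andP[-> uz] /=.
      exact: lt_trans uz zw.
    by exists z; rewrite !inE ?xz ?zw // ltxx andbF.
  by apply: IH; rewrite -ltnS; apply: leq_trans lt_card _.
Qed.

Lemma moebius_lt x y : (x < y)%O ->
  moebius x y = - \sum_(z : T | (x <= z < y)%O) moebius x z.
Proof.
move=> xy; rewrite -(@moebius_recE #|T|.+1 x y); last first.
  exact/leqW/max_card.
by rewrite /= lt_eqF.
Qed.

Lemma moebius_nle x y : ~~ (x <= y)%O -> moebius x y = 0.
Proof.
move=> nxy; rewrite /moebius; case: #|T| => [|k] /=.
  by case: eqP nxy => // ->; rewrite lexx.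
case: eqP nxy => [->|_ nxy]; first by rewrite lexx.
rewrite big_pred0 ?oppr0 // => z; apply/negbTE/negP => /andP[xz zy].
by rewrite (le_trans xz (ltW zy)) in nxy.
Qed.

End Moebius.

Section IntersectionLattice.
Context {K : fieldType} {vT : vectType K} {I : finType}.
Variable A : I -> {vspace vT}.

Definition flats : seq {vspace vT} :=
  [seq (\bigcap_(i in J) A i)%VS | J : {set I}].

Definition flat : Type := seq_sub flats.

HB.instance Definition _ := Finite.on flat.

(* Reverse inclusion: the ambient space is the least element. *)
Definition flat_le : rel flat := fun X Y => (ssval Y <= ssval X)%VS.

Fact flat_le_refl : reflexive flat_le.
Proof. by move=> X; rewrite /flat_le subvv. Qed.

Fact flat_le_anti : antisymmetric flat_le.
Proof.
move=> X Y /andP[YX XY]; apply/val_inj/eqP.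
by rewrite eqEsubv; apply/andP; split.
Qed.

Fact flat_le_trans : transitive flat_le.
Proof. by move=> Y X Z XY YZ; apply: subv_trans YZ XY. Qed.

Fact flat_display : Order.disp_t. Proof. exact: Order.Disp. Qed.

HB.instance Definition _ := Order.Le_isPOrder.Build flat_display flat
  flat_le_refl flat_le_anti flat_le_trans.

Fact fullv_flat : fullv \in flats.
Proof. by apply/imageP; exists set0; rewrite // big_set0. Qed.

Definition flat_ambient : flat := SeqSub fullv_flat.

Definition codim (X : flat) : nat := (\dim {:vT} - \dim (ssval X))%N.

End IntersectionLattice.

Section Braid.
Context {R : realType} {n : nat}.

Definition braid_index := {e : 'I_n * 'I_n | (e.1 < e.2)%N}.
HB.instance Definition _ := Finite.on braid_index.

Definition coord_diff (i j : 'I_n) (x : 'rV[R]_n) : R^o := x 0 i - x 0 j.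

Fact coord_diff_is_linear i j : linear (coord_diff i j).
Proof. by move=> a x y; rewrite /coord_diff !mxE scalerBr opprD addrACA. Qed.

HB.instance Definition _ i j :=
  GRing.isLinear.Build R 'rV[R]_n R^o _ (coord_diff i j)
    (coord_diff_is_linear i j).

Definition braid_hyperplane (i j : 'I_n) : {vspace 'rV[R]_n} :=
  lker (linfun (coord_diff i j)).

Lemma mem_braid_hyperplane i j (x : 'rV[R]_n) :
  (x \in braid_hyperplane i j) = (x 0 i == x 0 j).
Proof. by rewrite memv_ker lfunE /= subr_eq0. Qed.

Definition braid_arrangement (e : braid_index) : {vspace 'rV[R]_n} :=
  braid_hyperplane (val e).1 (val e).2.

End Braid.

Arguments braid_arrangement R n e : clear implicits.

Section PosetOn.
Variable n : nat.
Implicit Type le : rel 'I_n.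

Definition partial_order le :=
  [/\ reflexive le, antisymmetric le & transitive le].

Definition strict le : rel 'I_n := fun i j => (i != j) && le i j.

Definition incomparable le : rel 'I_n := fun i j => ~~ le i j && ~~ le j i.

Definition chain le (C : {set 'I_n}) := {in C &, total le}.

Definition antichain le (C : {set 'I_n}) : bool :=
  [forall i in C, forall j in C, (i != j) ==> incomparable le i j].

Definition width le : nat := \max_(C : {set 'I_n} | antichain le C) #|C|.

(* A permutation [s] stands for the word [s 0, s 1, ...], so that the position
   of [i] in this word is [s^-1 i]. *)
Definition linear_extension le (s : {perm 'I_n}) : bool :=
  [forall i, forall j, strict le i j ==> (s^-1%g i < s^-1%g j)%N].

Definition des le (P1 P2 : {set 'I_n}) (s : {perm 'I_n}) : nat :=
  #|[set i : 'I_n | [exists j : 'I_n,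
      [&& j == i.+1 :> nat, s i \in P2, s j \in P1
        & incomparable le (s i) (s j)]]]|.

Definition cone (R : realType) le (x : 'rV[R]_n) : Prop :=
  forall i j, strict le i j -> x 0 i < x 0 j.

Definition interior_flat (R : realType) le (X : flat (braid_arrangement R n)) :
    Prop :=
  exists x : 'rV[R]_n, x \in ssval X /\ cone le x.

Definition whitney (R : realType) le (k : nat) : nat :=
  \sum_(X : flat (braid_arrangement R n) |
      `[< interior_flat le X >] && (codim X == k))
    `|moebius (flat_ambient (braid_arrangement R n)) X|%N.

(* All codimensions are at most n, so the truncation at n loses nothing. *)
Definition Poin (R : realType) le : {poly int} :=
  \sum_(k < n.+1) (whitney R le k)%:R *: 'X^k.

End PosetOn.

(* Main.v *)
Require Import Defs.
From HB Require Import structures.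
From mathcomp Require Import all_boot all_order all_fingroup all_algebra.
From mathcomp Require Import boolp reals.
From mathcomp Require Import zify.

Set Implicit Arguments.
Unset Strict Implicit.
Unset Printing Implicit Defensive.

Import Order.TTheory GRing.Theory Num.Theory.
Local Open Scope ring_scope.

(* An interior flat [X] identifies only pairs of incomparable elements, one in
   each chain, and no element twice; hence the interval below [X] is Boolean,
   [|mu(V, X)| = 1], and [codim X] is the number of identified pairs. To a
   linear extension attach the flat identifying the two ends of each descent.
   The linear extension is recovered from the flat: an element [b] of the second
   chain precedes [a] in the first one iff [b <= a], or [b <= b'] and [a' <= a]
   for some identified pair [(b', a')]. On an arbitrary interior flat the same
   rule defines a linear extension, so this is a bijection. *)

(** * Möbius function and codimension of flats with a Boolean lower interval *)

Lemma alternating_sum_subsets (I : finType) (J : {set I}) : J != set0 ->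
  \sum_(B : {set I} | B \subset J) (-1) ^+ #|B| = 0 :> int.
Proof.
case/set0Pn=> e eJ.
(* Expand the product over all [i] of [w i + 1], where [w] is -1 on [J] and 0 elsewhere. The factor
   at [e] is zero, and only subsets of [J] survive in the expansion. *)
have := bigA_distr 1 (@GRing.add int)
  (fun i => if i \in J then -1 else 0) (fun=> 1).
rewrite (bigD1 e) //= eJ mul0r => /esym sum0.
rewrite -[RHS]sum0 [RHS](bigID (fun B : {set I} => B \subset J)) /=.
rewrite [X in _ = _ + X]big1 ?addr0 => [|B /subsetPn[i iB iJ]]; last first.
  by rewrite (bigD1 i) //= iB (negPf iJ) mul0r.
apply: eq_bigr => B /subsetP BJ.
rewrite -big_mkcond /= -[LHS](prodr_const (mem B)).
by apply: eq_bigr => i /BJ ->.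
Qed.

Section BooleanFlats.
Context {K : fieldType} {vT : vectType K} {I : finType}.
Context (A : I -> {vspace vT}).

Fact flat_of_subproof (J : {set I}) : (\bigcap_(i in J) A i)%VS \in flats A.
Proof. by apply/imageP; exists J. Qed.

Definition flat_of (J : {set I}) : flat A := SeqSub (flat_of_subproof J).

Lemma flat_of_surj (X : flat A) : exists J, X = flat_of J.
Proof. by case: X => X /[dup] /imageP[J _ XJ] p; exists J; apply/val_inj. Qed.

Lemma flat_of0 : flat_of set0 = flat_ambient A.
Proof. by apply/val_inj; rewrite /= big_set0. Qed.

Lemma ambient_le (X : flat A) : (flat_ambient A <= X)%O.
Proof. exact: subvf. Qed.

(* For such [J] the flats below [flat_of J] form a Boolean lattice. *)
Definition boolean_set (J : {set I}) :=
  forall (B : {set I}) e, B \subset J ->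
    (ssval (flat_of B) <= A e)%VS = (e \in B).

Lemma boolean_setS (B J : {set I}) :
  B \subset J -> boolean_set J -> boolean_set B.
Proof. by move=> BJ bJ C e CB; apply: bJ; apply: subset_trans BJ. Qed.

Lemma flat_of_le (B J : {set I}) : boolean_set J ->
  (flat_of B <= flat_of J)%O = (B \subset J).
Proof.
move=> bJ; apply/idP/subsetP => [leBJ e eB | BJ].
  rewrite -(bJ J) //; apply: subv_trans leBJ _.
  exact: bigcapv_inf eB (subvv (A e)).
apply/subv_bigcapP => e eB.
by rewrite (bJ J) // BJ.
Qed.

Lemma flat_of_inj (B C J : {set I}) : boolean_set J ->
  B \subset J -> C \subset J -> flat_of B = flat_of C -> B = C.
Proof.
move=> bJ BJ CJ eqBC; apply/setP => e.
by rewrite -(bJ B e BJ) -(bJ C e CJ) eqBC.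
Qed.

(** Strong induction on [#|J|]: the flats strictly below [flat_of J] are the pairwise distinct
    [flat_of B] with [B] a proper subset of [J], so the Möbius recursion becomes the alternating sum
    over subsets. *)
Lemma moebius_flat_of (J : {set I}) : boolean_set J ->
  moebius (flat_ambient A) (flat_of J) = (-1) ^+ #|J|.
Proof.
have [m] := ubnP #|J|; elim: m => // m IH in J * => leJm bJ.
have [->|J0] := eqVneq J set0; first by rewrite cards0 flat_of0 moebius_id.
have flat_lt (B : {set I}) : (flat_of B < flat_of J)%O = (B \proper J).
  rewrite lt_def flat_of_le // properEneq.
  have [BJ|] := boolP (B \subset J); last by rewrite !andbF.
  rewrite !andbT; congr negb; apply/eqP/eqP => [|->//].
  by move=> /(flat_of_inj bJ (subxx J) BJ).
rewrite moebius_lt; last by rewrite -flat_of0 flat_lt proper0.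
have -> : \sum_(z | (flat_ambient A <= z < flat_of J)%O)
            moebius (flat_ambient A) z =
          \sum_(z in flat_of @: [set B : {set I} | B \proper J])
            moebius (flat_ambient A) z.
  apply: eq_bigl => z; rewrite ambient_le /=; apply/idP/imsetP.
    have [B ->] := flat_of_surj z.
    by rewrite flat_lt => BJ; exists B; rewrite ?inE.
  by case=> B; rewrite inE => BJ ->; rewrite flat_lt.
rewrite big_imset /=; last first.
  move=> B C; rewrite !inE => /proper_sub BJ /proper_sub CJ.
  exact: flat_of_inj bJ BJ CJ.
have := alternating_sum_subsets J0; rewrite (bigD1 J) //= => /eqP.
rewrite addr_eq0 => /eqP ->; congr (- _); apply: eq_big => [B|B].
  by rewrite inE properEneq andbC.
rewrite inE => BJ; apply: IH; last exact: boolean_setS (proper_sub BJ) bJ.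
by rewrite -ltnS; apply: leq_trans leJm; apply/proper_card.
Qed.

(** Hyperplanes are added one at a time. Since [e] is not in [J :\ e], the form [f e] is nonzero on
    the flat of [J :\ e], so its image is a line and the dimension drops by exactly one. *)
Lemma codim_flat_of (f : I -> 'Hom(vT, K^o)) (J : {set I}) :
  (forall e, A e = lker (f e)) -> boolean_set J -> codim (flat_of J) = #|J|.
Proof.
move=> Af bJ; rewrite /codim.
suff <- : (\dim (ssval (flat_of J)) + #|J|)%N = \dim {:vT} by rewrite addKn.
have [m] := ubnP #|J|; elim: m => // m IH in J bJ * => leJm.
have [->|/set0Pn[e eJ]] := eqVneq J set0.
  by rewrite /= big_set0 cards0 addn0.
have J'J := subD1set J e.
rewrite (cardsD1 e J) eJ in leJm *.
rewrite -(IH (J :\ e)) //; last exact: boolean_setS J'J bJ.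
rewrite /= (big_setD1 e) //= capvC Af addnA; congr (_ + _)%N.
rewrite -[RHS](limg_ker_dim (f e)); congr (_ + _)%N.
apply/esym/anti_leq/andP; split.
  by apply: leq_trans (dimvS (subvf _)) _; rewrite dimvf.
rewrite lt0n dimv_eq0 -lkerE -Af.
by have /= -> := bJ _ e J'J; rewrite !inE eqxx.
Qed.

End BooleanFlats.

(** * Permutations and total orders *)

Lemma perm_of_total_order n (r : rel 'I_n) :
  total r -> antisymmetric r -> transitive r ->
  exists s : {perm 'I_n}, forall u v, (s^-1%g u < s^-1%g v)%N = ~~ r v u.
Proof.
move=> r_total r_anti r_trans.
have r_refl u : r u u by have := r_total u u; rewrite orbb.
(* By totality and antisymmetry these are the elements strictly below [u]; their number is the
   position of [u], counted from 0. *)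
pose below u := [set w | ~~ r u w].
have below_lt u : (#|below u| < n)%N.
  rewrite -[X in (_ < X)%N]card_ord -cardsT; apply/proper_card/properP.
  by split; [exact: subsetT | exists u; rewrite !inE ?r_refl].
pose rank u := Ordinal (below_lt u).
have rank_lt u v : ~~ r v u -> (rank u < rank v)%N.
  move=> rvu; apply/proper_card/properP; split; last first.
    by exists u; rewrite !inE ?r_refl.
  apply/subsetP => w; rewrite !inE; apply: contra => rvw.
  by have /orP[//|rwu] := r_total u w; rewrite (r_trans w) in rvu.
have rankE u v : (rank u < rank v)%N = ~~ r v u.
  apply/idP/idP; last exact: rank_lt.
  apply: contraL => rvu; rewrite -leqNgt.
  have [->//|uv] := eqVneq u v.
  by apply/ltnW/rank_lt; apply: contra uv => ruv; apply/eqP/r_anti/andP.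
have rank_inj : injective rank.
  move=> u v /(congr1 val) /= eq_uv; apply: r_anti.
  by rewrite -[r u v]negbK -[r v u]negbK -!rankE /= eq_uv ltnn.
by exists (perm rank_inj)^-1%g => u v; rewrite invgK !permE rankE.
Qed.

(** Each value [w u] equals the number of [v] with a smaller value, so comparisons alone determine
    [w]; this is applied to the inverses. *)
Lemma perm_inv_lt_inj n (s t : {perm 'I_n}) :
  (forall u v, (s^-1%g u < s^-1%g v)%N = (t^-1%g u < t^-1%g v)%N) -> s = t.
Proof.
have rankE (w : {perm 'I_n}) u : w u = #|[set v | (w v < w u)%N]| :> nat.
  rewrite -(card_imset _ (@perm_inj _ w)).
  have -> : w @: [set v | (w v < w u)%N] = [set i : 'I_n | (i < w u)%N].
    apply/setP => i; rewrite inE; apply/imsetP/idP => [[v]|iu].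
      by rewrite inE => ? ->.
    by exists (w^-1%g i); rewrite ?inE permKV.
  rewrite cardsE -sum1_card (big_ord_narrow (ltnW (ltn_ord _))) /=.
  by rewrite sum1_card card_ord.
move=> st; apply/invg_inj/permP => u; apply/val_inj.
rewrite /= [LHS]rankE [RHS]rankE.
by apply: eq_card => v; rewrite !inE st.
Qed.

(** * Flats of the braid arrangement as sets of identified pairs *)

Section Joined.
Context {n : nat}.
Implicit Types (B : {set @braid_index n}) (u v : 'I_n) (e : @braid_index n).

Definition joined B u v : bool :=
  [exists e in B, (val e == (u, v)) || (val e == (v, u))].

Lemma joinedC B u v : joined B u v = joined B v u.
Proof. by apply: eq_existsb => e; rewrite orbC. Qed.

Lemma joinedE B e : joined B (val e).1 (val e).2 = (e \in B).
Proof.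
apply/existsP/idP => [[f /andP[fB /orP[]/eqP ef]]|eB].
- by rewrite -(_ : f = e) //; apply/val_inj; rewrite ef; case: (val e).
- have := valP f; have := valP e; rewrite ef /= => lt1 /(ltn_trans lt1).
  by rewrite ltnn.
- by exists e; rewrite eB; case: (val e) => ? ?; rewrite eqxx.
Qed.

Lemma braid_index_of u v : u != v ->
  exists e, val e = (u, v) \/ val e = (v, u).
Proof.
rewrite neq_ltn => /orP[] lt_uv.
  by exists (exist _ (u, v) lt_uv); left.
by exists (exist _ (v, u) lt_uv); right.
Qed.

Lemma mem_braid_flat_of (R : realType) B (x : 'rV[R]_n) :
  reflect (forall u v, joined B u v -> x 0 u = x 0 v)
    (x \in ssval (flat_of (braid_arrangement R n) B)).
Proof.
rewrite memvE; apply: (iffP subv_bigcapP) => [xB u v /existsP[e]|xB e eB].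
  case/andP=> /xB; rewrite -memvE mem_braid_hyperplane => /eqP xe.
  by case/orP => /eqP eE; move: xe; rewrite eE /= => ->.
rewrite -memvE mem_braid_hyperplane; apply/eqP/xB.
by rewrite joinedE.
Qed.

End Joined.

(** * Linear extensions and the flats of their descents *)

Section Chains.
Context {R : realType} {n : nat} {le : rel 'I_n} {P : {set 'I_n}}.
Context (le_order : partial_order le).
Context (chain1 : chain le P) (chain2 : chain le (~: P)).
Implicit Types (s t : {perm 'I_n}) (a b u v w : 'I_n) (M : rel 'I_n).

Local Notation A := (braid_arrangement R n).

Let poset_refl : reflexive le. Proof. by case: le_order. Qed.
Let poset_anti : antisymmetric le. Proof. by case: le_order. Qed.
Let poset_trans : transitive le. Proof. by case: le_order. Qed.

Local Notation pos s v := (s^-1%g v).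

Lemma pos_inj s u v : pos s u = pos s v :> nat -> u = v.
Proof. by move/val_inj/perm_inj. Qed.

Lemma linear_extensionP s : reflect
  (forall u v, strict le u v -> (pos s u < pos s v)%N) (linear_extension le s).
Proof.
apply: (iffP forallP) => [ext u v | ext u].
  by move/forallP: (ext u) => /(_ v) /implyP.
by apply/forallP => v; apply/implyP/ext.
Qed.

Lemma linear_extension_le s u v :
  linear_extension le s -> le u v -> (pos s u <= pos s v)%N.
Proof.
move=> /linear_extensionP ext uv; have [->//|neq_uv] := eqVneq u v.
by apply/ltnW/ext/andP.
Qed.

(** Elements on the same side of [P] are comparable, so [le] forces their order in every linear
    extension. *)
Lemma linear_extension_chain s u v : linear_extension le s ->
  (u \in P) = (v \in P) -> (pos s u < pos s v)%N = ~~ le v u.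
Proof.
move=> ext uvP; have uv_total : le u v || le v u.
  have [vP|vP] := boolP (v \in P); first by apply: chain1; rewrite ?uvP.
  by apply: chain2; rewrite inE ?uvP.
apply/idP/idP => [|nvu].
  by apply: contraL => /(linear_extension_le ext); rewrite -leqNgt.
move: uv_total; rewrite (negPf nvu) orbF => uv.
apply: (linear_extensionP _ ext); rewrite /strict uv andbT.
by apply: contra nvu => /eqP->.
Qed.

(** The descents counted by [des], seen as pairs of letters instead of positions. *)
Definition descent s : rel 'I_n := fun u v =>
  [&& pos s v == (pos s u).+1 :> nat, u \notin P, v \in P
    & incomparable le u v].

Definition descents s : {set @braid_index n} :=
  [set e | descent s (val e).1 (val e).2 || descent s (val e).2 (val e).1].

Lemma joined_descents s u v :
  joined (descents s) u v = descent s u v || descent s v u.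
Proof.
have [->|/braid_index_of[e]] := eqVneq u v.
  have /negbTE-> : ~~ descent s v v.
    by rewrite /descent; case: (v \in P); rewrite !andbF.
  apply/existsP => -[e /andP[_]]; rewrite orbb => /eqP eE.
  by have := valP e; rewrite eE ltnn.
case=> eE; last rewrite joinedC orbC.
  by have := joinedE (descents s) e; rewrite inE eE.
by have := joinedE (descents s) e; rewrite inE eE.
Qed.

(** A braid index forgets which end of the descent comes first; membership in [P] restores it. *)
Lemma descentE s u v :
  descent s u v = [&& joined (descents s) u v, u \notin P & v \in P].
Proof.
rewrite joined_descents /descent.
by case: (u \in P); case: (v \in P); rewrite /= ?andbF ?orbF ?andbT.
Qed.

(* Heights along [s], where the two ends of each pair of [B] share a height. *)
Definition level (B : {set @braid_index n}) s v : nat :=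
  (pos s v - [exists u, descent s u v && joined B u v])%N.

Lemma level_joined B s u v : descent s u v -> joined B u v ->
  level B s u = level B s v.
Proof.
move=> uv uvB; rewrite /level.
have /negbTE-> : ~~ [exists w, descent s w u && joined B w u].
  apply/existsP => -[w /andP[/and4P[_ _ uP _] _]].
  by case/and4P: uv => _; rewrite uP.
have -> : [exists w, descent s w v && joined B w v].
  by apply/existsP; exists u; rewrite uv.
by case/and4P: uv => /eqP -> _ _ _; rewrite subn0 subn1.
Qed.

(** Only [v] being lowered could harm. Then its immediate predecessor [w] is joined to it, so [u]
    differs from [w] and stands before it, while [v] drops just to the position of [w]. *)
Lemma level_lt B s u v : (pos s u < pos s v)%N ->
  ~~ (descent s u v && joined B u v) -> (level B s u < level B s v)%N.
Proof.
move=> uv nuv; apply: leq_ltn_trans (leq_subr _ _) _; rewrite /level.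
case: existsP => [[w /andP[wv wvB]]|_]; last by rewrite subn0.
have vE : val (pos s v) = (pos s w).+1 by case/and4P: (wv) => /eqP.
rewrite vE subn1 /= ltn_neqAle; apply/andP; split; last by rewrite -ltnS -vE.
apply: contra nuv => /eqP/pos_inj->.
by rewrite wv.
Qed.

Lemma level_mem_flat (B : {set @braid_index n}) s : B \subset descents s ->
  (\row_v (level B s v)%:R : 'rV[R]_n) \in ssval (flat_of A B).
Proof.
move=> /subsetP sB; apply/mem_braid_flat_of => u v uvB; rewrite !mxE.
have: joined (descents s) u v.
  by case/existsP: uvB => e /andP[/sB ? ?]; apply/existsP; exists e; apply/andP.
rewrite joined_descents => /orP[] uv; first by rewrite (level_joined uv).
by rewrite (level_joined uv) // joinedC.
Qed.

(** The vector of levels for [B] lies in the flat of [B] and takes different values at the two ends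
    of every index outside [B]. *)
Lemma boolean_descents s : boolean_set A (descents s).
Proof.
move=> B e sB; apply/idP/idP => [|eB]; last first.
  exact: bigcapv_inf eB (subvv (A e)).
move/subvP/(_ _ (level_mem_flat sB)).
rewrite mem_braid_hyperplane !mxE eqr_nat => /eqP eq_lev.
have := valP e; rewrite -joinedE; case: (val e) eq_lev => u v /= eq_lev uv.
have [lt|lt|/pos_inj eq_uv] := ltngtP (pos s u) (pos s v).
- apply: contraT => nuv.
  have := @level_lt B s u v lt.
  by rewrite eq_lev ltnn (negPf nuv) andbF => /(_ isT).
- apply: contraT; rewrite joinedC => nuv.
  have := @level_lt B s v u lt.
  by rewrite eq_lev ltnn (negPf nuv) andbF => /(_ isT).
- by rewrite eq_uv ltnn in uv.
Qed.

(** The level vector is again the witness: the ends of a descent are incomparable, so strict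
    relations keep strictly increasing levels. *)
Lemma interior_descents s : linear_extension le s ->
  interior_flat le (flat_of A (descents s)).
Proof.
move=> /linear_extensionP ext.
exists (\row_v (level (descents s) s v)%:R); split; first exact: level_mem_flat.
move=> u v uv; rewrite !mxE ltr_nat; apply: level_lt (ext u v uv) _.
by case/andP: uv => _ uv; rewrite /descent /incomparable uv !andbF.
Qed.

(** Each pair is sent to the position of its first letter, which determines the second letter as its
    successor. *)
Lemma card_descents s : #|descents s| = des le P (~: P) s.
Proof.
pose source (e : @braid_index n) :=
  if descent s (val e).1 (val e).2 then (val e).1 else (val e).2.
have sourceP (e : @braid_index n) : e \in descents s ->
    exists2 v, descent s (source e) v &
    (val e = (source e, v) \/ val e = (v, source e)).
  rewrite inE /source; case: (val e) => u v /=.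
  by case: ifP => [uv _ | _ /= vu]; [exists v | exists u]; auto.
rewrite -(@card_in_imset _ _ (fun e => pos s (source e))); last first.
  move=> e f /sourceP[v ev eE] /sourceP[w fw fE] /perm_inj ef.
  have vw : v = w.
    case/and4P: ev => /eqP ev _ _ _; case/and4P: fw => /eqP fw _ _ _.
    by apply: (@pos_inj s); rewrite ev fw ef.
  rewrite -ef -vw in fE; have := valP e; have := valP f.
  (* Equal orientations give equal indices; opposite ones contradict the increasing order inside an
     index. *)
  by case: eE fE => eE [] fE; rewrite eE fE /= => lt1 lt2;
    try (by apply: val_inj; rewrite eE fE);
    have := ltn_trans lt1 lt2; rewrite ltnn.
apply: eq_card => i; rewrite inE; apply/imsetP/existsP => [[e]|[j]].
  case/sourceP=> v /and4P[ev e1 e2 e3] _ ->; exists (pos s v).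
  by rewrite !permKV ev inE e1 e2.
case/and4P=> ij iP jP inc; rewrite inE in iP.
have dij : descent s (s i) (s j) by rewrite /descent !permK ij iP jP.
have nij : s i != s j by apply: contraNneq iP => ->.
have [e eE] := braid_index_of nij.
have eD : e \in descents s by rewrite inE; case: eE => -> /=; rewrite dij ?orbT.
exists e => //; rewrite /source; case: eE => -> /=; rewrite ?dij ?permK //.
by case: ifP => [/and4P[_]|]; rewrite ?jP ?permK.
Qed.

(* The rule recovering a linear extension from its descents [M], for [b] outside
   [P] and [a] in [P]. *)
Definition before M b a : bool :=
  le b a || [exists p : 'I_n * 'I_n, [&& M p.1 p.2, le b p.1 & le p.2 a]].

Lemma beforeP M b a :
  reflect (le b a \/ exists b' a', [/\ M b' a', le b b' & le a' a])
    (before M b a).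
Proof.
apply: (iffP orP) => -[|].
- by left.
- by case/existsP=> -[b' a'] /and3P[? ? ?]; right; exists b', a'.
- by left.
- by case=> b' [a' [? ? ?]]; right; apply/existsP; exists (b', a'); apply/and3P.
Qed.

Lemma before_mono M b b' a a' :
  le b' b -> le a a' -> before M b a -> before M b' a'.
Proof.
move=> bb aa /beforeP[ba|[c [d [cd bc da]]]]; apply/beforeP.
  by left; apply: poset_trans (poset_trans bb ba) aa.
right; exists c, d.
by split=> //; [apply: poset_trans bc | apply: poset_trans aa].
Qed.

Lemma before_descent s b a : linear_extension le s -> b \notin P -> a \in P ->
  (pos s b < pos s a)%N = before (descent s) b a.
Proof.
move=> ext bP aP; apply/idP/beforeP => [ba|[ba|[b' [a' [ba' bb' aa']]]]].
(* Take the last letter [s i] outside [P] before [a]. Its successor [s j] is in [P], and the chains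
   give [b <= s i] and [s j <= a]. Either [s i], [s j] form a descent, or [s i <= s j] and then
   [b <= a]. *)
- pose Q (i : 'I_n) := (s i \notin P) && (i < pos s a)%N.
  have Qb : Q (pos s b) by rewrite /Q permKV bP.
  have [i /andP[iP ia] imax] := arg_maxnP (val : 'I_n -> nat) Qb.
  have i1n : (i.+1 < n)%N by apply: leq_ltn_trans ia _.
  pose j := Ordinal i1n.
  have jP : s j \in P.
    move: ia; rewrite leq_eqVlt => /orP[/eqP ja|ja].
      by rewrite (_ : j = pos s a) ?permKV //; apply: val_inj.
    apply: contraT => jP; have := imax j.
    by rewrite /Q jP ja /= ltnn => /(_ isT).
  have bi : le b (s i).
    rewrite -[le _ _]negbK -(linear_extension_chain ext) //.
      by rewrite permK -leqNgt; apply: imax.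
    by rewrite (negPf iP) (negPf bP).
  have ja : le (s j) a.
    rewrite -[le _ _]negbK -(linear_extension_chain ext) ?jP //.
    by rewrite permK -leqNgt.
  have [inc|] := boolP (incomparable le (s i) (s j)).
    right; exists (s i), (s j); split => //.
    by rewrite /descent !permK eqxx iP jP.
  rewrite negb_and !negbK => /orP[ij|/(linear_extension_le ext)].
    by left; apply: poset_trans (poset_trans bi ij) ja.
  by rewrite !permK /= ltnn.
- apply: (linear_extensionP _ ext); rewrite /strict ba andbT.
  by apply: contraNneq bP => ->.
- apply: leq_ltn_trans (linear_extension_le ext bb') _.
  apply: leq_trans (linear_extension_le ext aa').
  by case/and4P: ba' => /eqP ->.
Qed.

(** Within a side the order is forced by [le]; across the sides [before] computes it from the
    descents alone. *)
Lemma descents_inj : {in linear_extension le &, injective descents}.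
Proof.
move=> s t sE tE st.
have eq_before b a : before (descent s) b a = before (descent t) b a.
  congr orb; apply: eq_existsb => p; congr andb.
  by rewrite !descentE st.
have mixed b a : b \notin P -> a \in P ->
    (pos s b < pos s a)%N = (pos t b < pos t a)%N.
  by move=> bP aP; rewrite !before_descent ?eq_before.
apply: perm_inv_lt_inj => u v.
have [uv|] := eqVneq (u \in P) (v \in P).
  by rewrite !linear_extension_chain.
have lt_neg (w : {perm 'I_n}) : u != v ->
    (pos w u < pos w v)%N = ~~ (pos w v < pos w u)%N.
  move=> neq; rewrite ltn_neqAle -leqNgt.
  by case: eqP => // /pos_inj/eqP; rewrite (negPf neq).
have [uP|uP] := boolP (u \in P); have [vP|vP] := boolP (v \in P) => // _.
  have neq : u != v by apply: contraNneq vP => <-.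
  by rewrite [LHS]lt_neg // [RHS]lt_neg // mixed.
exact: mixed.
Qed.

Lemma cone_incomparable (x : 'rV[R]_n) u v :
  cone le x -> u != v -> x 0 u = x 0 v -> incomparable le u v.
Proof.
move=> x_cone neq xuv; apply/andP; split; apply/negP => uv.
  by have := @x_cone u v; rewrite /strict neq uv xuv ltxx => /(_ isT).
have := @x_cone v u.
by rewrite /strict eq_sym neq uv xuv ltxx => /(_ isT).
Qed.

(** * From a point of the cone and its identified pairs to a linear extension *)

Section FromFlat.
Context (M : rel 'I_n) (x : 'rV[R]_n).
Context (M_ends : forall b a, M b a -> (b \notin P) && (a \in P)).
Context (x_cone : cone le x) (x_M : forall b a, M b a -> x 0 b = x 0 a).

Let x_le u v : le u v -> x 0 u <= x 0 v.
Proof.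
move=> uv; have [->//|neq_uv] := eqVneq u v.
by apply/ltW/x_cone/andP.
Qed.

(** Mixed pairs in the two orientations get complementary values, which makes totality and
    antisymmetry immediate; transitivity rests on [before_mono]. *)
Definition merge_order : rel 'I_n := fun u v =>
  if (u \notin P) && (v \in P) then before M u v
  else if (u \in P) && (v \notin P) then ~~ before M v u
  else le u v.

Lemma merge_order_total : total merge_order.
Proof.
move=> u v; rewrite /merge_order.
have [uP|uP] := boolP (u \in P); have [vP|vP] := boolP (v \in P) => /=.
- exact: chain1.
- by rewrite orNb.
- by rewrite orbN.
- by apply: chain2; rewrite inE.
Qed.

Lemma merge_order_anti : antisymmetric merge_order.
Proof.
move=> u v; rewrite /merge_order.
have [uP|uP] := boolP (u \in P); have [vP|vP] := boolP (v \in P) => /=.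
- exact: poset_anti.
- by rewrite andNb.
- by rewrite andbN.
- exact: poset_anti.
Qed.

Lemma merge_order_trans : transitive merge_order.
Proof.
move=> v u w; rewrite /merge_order.
have cP a b : a \in P -> b \in P -> ~~ le a b -> le b a.
  by move=> aP bP; have := chain1 aP bP; case: le.
have cQ a b : a \notin P -> b \notin P -> ~~ le a b -> le b a.
  move=> aP bP; have /(_ a b) := chain2.
  by rewrite !inE => /(_ aP bP); case: le.
have [uP|uP] := boolP (u \in P); have [vP|vP] := boolP (v \in P);
  have [wP|wP] := boolP (w \in P) => /=.
- exact: poset_trans.
- by move=> uv; apply: contra; apply: before_mono.
(* If [w <= u], then [before M v w] would extend to [before M v u]. *)
- move=> nvu vw; apply: contraT => /(cP _ _ uP wP) wu.
  by case/negP: nvu; apply: before_mono vw.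
- by move=> nvu vw; apply: contra nvu; apply: before_mono.
- by move=> uv vw; apply: before_mono uv.
- move=> uv nwv; apply: contraT => /(cQ _ _ uP wP) wu.
  by case/negP: nwv; apply: before_mono uv.
- by move=> uv; apply: before_mono.
- exact: poset_trans.
Qed.

Lemma exists_linear_extension :
  exists2 s, linear_extension le s & descent s =2 M.
Proof.
have [s sE] := perm_of_total_order merge_order_total merge_order_anti
  merge_order_trans.
have M_inc b a : M b a -> incomparable le b a.
  move=> ba; have /andP[bP aP] := M_ends ba.
  apply: cone_incomparable x_cone _ (x_M ba).
  by apply: contraNneq bP => ->.
have ext : linear_extension le s.
  apply/linear_extensionP => u v /[dup] uv /andP[neq_uv le_uv].
  rewrite sE /merge_order.
  have nvu : ~~ le v u.
    by apply: contra neq_uv => vu; apply/eqP/poset_anti; rewrite le_uv.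
  have [uP|uP] := boolP (u \in P); have [vP|vP] := boolP (v \in P) => //=.
    (* A pair [M b a] with [v <= b] and [a <= u] would give [a <= u <= v <= b], against
       incomparability. *)
    apply/beforeP => -[|[b [a [ba vb au]]]]; first exact/negP.
    have /andP[_ /negP[]] := M_inc _ _ ba.
    by apply: poset_trans au (poset_trans le_uv vb).
  by rewrite negbK; apply/beforeP; left.
have pos_lt b a : b \notin P -> a \in P ->
    (pos s b < pos s a)%N = before M b a.
  by move=> bP aP; rewrite sE /merge_order aP bP negbK.
exists s => // b a; apply/idP/idP => [/and4P[/eqP ba bP aP inc]|ba].
  have : before M b a by rewrite -pos_lt // ba.
  case/beforeP => [ba_le|[b' [a' [ba' bb' aa']]]].
    by case/andP: inc; rewrite ba_le.
  have /andP[bP' aP'] := M_ends ba'.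
  have : (pos s b' < pos s a')%N.
    by rewrite pos_lt //; apply/beforeP; right; exists b', a'.
  (* The positions satisfy [b <= b' < a' <= a] while [a] comes right after [b], so the two pairs
     coincide. *)
  have := linear_extension_le ext bb'; have := linear_extension_le ext aa'.
  move=> h1 h2 h3.
  have -> : b = b' by apply: (@pos_inj s); lia.
  by have -> : a = a' by apply: (@pos_inj s); lia.
have /andP[bP aP] := M_ends ba; have inc := M_inc _ _ ba.
rewrite /descent bP aP inc !andbT.
have before_ba : before M b a by apply/beforeP; right; exists b, a.
have := before_ba; rewrite -pos_lt // leq_eqVlt => /orP[/eqP->//|lt].
(* Otherwise some letter [u] follows [b] immediately and precedes [a]. If [u] is in [P], then
   [u < a], and a pair [M b' a'] putting [b] before [u] gives
   [x b <= x b' = x a' <= x u < x a = x b]. Outside [P] the argument is symmetric, with [b < u]. *)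
have i1n : ((pos s b).+1 < n)%N by apply: ltn_trans lt _.
pose u := s (Ordinal i1n).
have bu : (pos s b < pos s u)%N by rewrite permK.
have ua : (pos s u < pos s a)%N by rewrite permK.
have [/negP nba /negP nab] := andP inc.
have [uP|uP] := boolP (u \in P).
  have nau : ~~ le a u by rewrite -(linear_extension_chain ext) // uP aP.
  have le_ua : le u a by have := chain1 uP aP; rewrite (negPf nau) orbF.
  have sua : strict le u a.
    by rewrite /strict le_ua andbT; apply: contraNneq nau => ->.
  move: bu; rewrite pos_lt // => /beforeP[bu|[b' [a' [ba' bb' aa']]]].
    by case: nba; apply: poset_trans le_ua.
  have := x_cone sua; rewrite ltNge => /negP[]; rewrite -(x_M ba).
  by rewrite (le_trans (x_le bb')) // (x_M ba') x_le.
have nub : ~~ le u b.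
  by rewrite -(linear_extension_chain ext) // (negPf uP) (negPf bP).
have le_bu : le b u.
  by have /(_ b u) := chain2; rewrite !inE (negPf nub) orbF; apply.
have sbu : strict le b u.
  by rewrite /strict le_bu andbT; apply: contraNneq nub => ->.
move: ua; rewrite pos_lt // => /beforeP[ua|[b' [a' [ba' bb' aa']]]].
  by case: nba; apply: poset_trans ua.
have := x_cone sbu; rewrite ltNge => /negP[]; rewrite (x_M ba).
by apply: le_trans (x_le aa'); rewrite -(x_M ba') x_le.
Qed.

End FromFlat.

Lemma interior_flat_descents (X : flat A) : interior_flat le X ->
  exists2 s, linear_extension le s & X = flat_of A (descents s).
Proof.
case=> x [xX x_cone]; have [J XJ] := flat_of_surj X.
(* [M] uses every hyperplane containing [X], not only those in [J], and orients each pair from the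
   complement of [P] to [P]. *)
pose M : rel 'I_n := fun b a =>
  [&& b \notin P, a \in P & (ssval X <= braid_hyperplane b a)%VS].
have x_eq u v : (ssval X <= braid_hyperplane u v)%VS -> x 0 u = x 0 v.
  by move=> /subvP/(_ _ xX); rewrite mem_braid_hyperplane => /eqP.
have [b a|b a|s ext sM] := @exists_linear_extension M x _ x_cone.
- by case/and3P=> -> ->.
- by case/and3P=> _ _ /x_eq.
have HC u v : braid_hyperplane u v = braid_hyperplane v u :> {vspace 'rV[R]_n}.
  by apply/vspaceP => y; rewrite !mem_braid_hyperplane eq_sym.
exists s => //; apply/val_inj/eqP; rewrite eqEsubv /=; apply/andP; split.
  apply/subv_bigcapP => e; rewrite inE !sM.
  by case/orP => /and3P[_ _] //; rewrite HC.
rewrite [X in (_ <= ssval X)%VS]XJ; apply/subv_bigcapP => e eJ.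
have XA : (ssval X <= A e)%VS by rewrite XJ; apply: bigcapv_inf eJ (subvv _).
apply: bigcapv_inf (subvv _); rewrite inE !sM /M.
have := valP e; rewrite {}/braid_arrangement in XA *.
case: (val e) XA => u v /= XH uv; rewrite XH (HC v u) XH !andbT.
have neq : u != v by rewrite neq_ltn uv.
have /andP[nuv nvu] := cone_incomparable x_cone neq (x_eq _ _ XH).
(* Incomparable ends cannot lie on the same side of [P], so exactly one orientation of the pair is
   in [M]. *)
have := @chain1 u v; have := @chain2 u v; rewrite !inE (negPf nuv) (negPf nvu).
by case: (u \in P); case: (v \in P) => //= c2 c1;
  [have := c1 isT isT | have := c2 isT isT].
Qed.

(** * The Poincaré polynomial as a sum over linear extensions *)

Lemma Poin_descents :
  Poin R le = \sum_(s : {perm 'I_n} | linear_extension le s)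
                 'X^(des le P (~: P) s).
Proof.
pose F s := flat_of A (descents s).
have F_inj : {in linear_extension le &, injective F}.
  move=> s t sE tE Fst; apply: descents_inj => //; apply/setP => e.
  rewrite -(boolean_descents e (subxx (descents s))).
  by rewrite -(boolean_descents e (subxx (descents t))) -/(F s) Fst.
have codim_lt (X : flat A) : (codim X < n.+1)%N.
  by rewrite ltnS (leq_trans (leq_subr _ _)) // dimvf /dim /= mul1n.
(* The coefficients are unfolded into one sum over interior flats, grouped by codimension. *)
have -> : Poin R le = \sum_(X : flat A | `[< interior_flat le X >])
    `|moebius (flat_ambient A) X|%N%:R *: 'X^(codim X).
  rewrite [RHS](partition_big (fun X => Ordinal (codim_lt X)) xpredT) //=.
  apply: eq_bigr => k _; rewrite /whitney natr_sum scaler_suml.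
  by apply: eq_bigr => X /andP[_ /eqP->].
transitivity (\sum_(X in F @: linear_extension le)
    `|moebius (flat_ambient A) X|%N%:R *: 'X^(codim X) : {poly int}).
  apply: eq_bigl => X; apply/asboolP/imsetP => [/interior_flat_descents[s]|[s]].
    by exists s.
  by move=> sE ->; apply: interior_descents.
rewrite big_imset //=; apply: eq_bigr => s _.
rewrite moebius_flat_of; last exact: boolean_descents.
pose f (e : braid_index) : 'Hom('rV[R]_n, R^o) :=
  linfun (coord_diff (val e).1 (val e).2).
rewrite (codim_flat_of (f := f)) //.
  by rewrite card_descents abszX /= exp1n scale1r.
exact: boolean_descents.
Qed.

End Chains.

Theorem theorem1p5 (R : realType) (n : nat) (le : rel 'I_n)
    (P1 P2 : {set 'I_n}) (le_order : partial_order le)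
    (width2 : width le = 2%N) (cover : P1 :|: P2 = [set: 'I_n])
    (chain1 : chain le P1) (chain2 : chain le P2) :
  Poin R le = \sum_(s : {perm 'I_n} | linear_extension le s)
                 'X^(des le P1 P2 s).
Proof.
(* The two chains may overlap, so [P2] is first replaced by the complement of [P1]. *)
have sub2 u : u \notin P1 -> u \in P2.
  by have := in_setT u; rewrite -cover inE => /orP[->|].
have chainC : chain le (~: P1).
  by move=> u v; rewrite !inE => /sub2 uP /sub2 vP; apply: chain2.
rewrite (Poin_descents le_order chain1 chainC).
apply: eq_bigr => s _; congr ('X^_); apply: eq_card => i; rewrite !inE.
apply: eq_existsb => j; congr andb.
(* A letter [s i] in both chains adds no descent: a following letter in [P1] is comparable to it. *)
have [iP|/sub2->//] := boolP (s i \in P1).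
have [jP|_] := boolP (s j \in P1); last by rewrite !andbF.
by rewrite /incomparable -negb_or chain1 // !andbF.
Qed.
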